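(* Let $r\geq 1$ and consider the Lie algebra of type $A_r$. Let $\ell$ and $m_1,\dots,m_r$ be nonnegative integers, $\lambda=\ell\varpi_1$ and $\mu=\sum_{i=1}^r m_i\varpi_i$. \begin{enumerate} \item If $\ell-\sum_{i=1}^r i\,m_i\equiv 0 \pmod{r+1}$, then $s_1\notin\mathcal{A}(\lambda,\mu)$. \item If $\ell-\sum_{i=1}^r i\,m_i=0$ and $m_j=0$ for all $3\leq j\leq r$, then $\mathcal{A}(\lambda,\mu)=\{1\}$. \item If $\ell-\sum_{i=1}^r i\,m_i=0$, $m_j=0$ for all $4\leq j\leq r$, and $m_3\neq 0$, then $\mathcal{A}(\lambda,\mu)=\{1,s_2\}$. \item If $\ell-\sum_{i=1}^r i\,m_i=0$, $m_j=0$ for all $5\leq j\leq r$, and $m_4\neq 0$, then $\mathcal{A}(\lambda,\mu)=\{1,s_2,s_3,s_2s_3\}$ if $m_4=1$, and $\mathcal{A}(\lambda,\mu)=\{1,s_2,s_3,s_2s_3,s_3s_2,s_2s_3s_2\}$ if $m_4\geq 2$. \end{enumerate}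
   Context: Type $A_r$: simple roots $\alpha_1,\dots,\alpha_r$; positive roots $\Phi^+=\{\alpha_i+\alpha_{i+1}+\cdots+\alpha_j: 1\le i\le j\le r\}$. Fundamental weights $\varpi_i=\frac{r+1-i}{r+1}(\alpha_1+2\alpha_2+\cdots+(i-1)\alpha_{i-1})+\frac{i}{r+1}((r-i+1)\alpha_i+(r-i)\alpha_{i+1}+\cdots+\alpha_r)$, and $\rho=\varpi_1+\cdots+\varpi_r$ (half the sum of positive roots). The Weyl group $W$ is generated by the simple reflections $s_1,\dots,s_r$, with $s_i(\alpha_i)=-\alpha_i$, $s_i(\alpha_j)=\alpha_i+\alpha_j$ if $|i-j|=1$, $s_i(\alpha_j)=\alpha_j$ if $|i-j|>1$, and $s_i(\varpi_j)=\varpi_j-\delta_{ij}\alpha_i$; $1$ denotes the identity. Kostant's partition function $\wp(\xi)$ is the number of ways to write $\xi$ as a nonnegative integral linear combination of positive roots. The Weyl alternation set is $\mathcal{A}(\lambda,\mu)=\{\sigma\in W:\wp(\sigma(\lambda+\rho)-(\mu+\rho))>0\}$. *)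

(* Defs.v *)
From HB Require Import structures.
From mathcomp Require Import all_boot all_order all_algebra finmap.
From mathcomp Require Import all_classical.

Set Implicit Arguments.
Unset Strict Implicit.
Unset Printing Implicit Defensive.

Import Order.TTheory GRing.Theory Num.Theory.

Local Open Scope classical_set_scope.
Local Open Scope ring_scope.

(* Vectors are columns of rational coordinates in the basis of simple roots
   of type A_r, and linear maps are matrices acting on the left, so that the
   product of the Weyl group is [*m].  Simple roots, reflections and
   fundamental weights are indexed by naturals starting from 1, as usual;
   only the indices 1 <= i <= r are meaningful. *)

Definition alpha (r i : nat) : 'cV[rat]_r := \col_(k < r) (k.+1 == i)%:R.

(* The pair (i, j) stands for the root alpha_(i+1) + ... + alpha_(j+1). *)
Definition posroot (r : nat) := {p : 'I_r * 'I_r | (p.1 <= p.2)%N}.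

Definition root_vec (r : nat) (p : posroot r) : 'cV[rat]_r :=
  \sum_((val p).1.+1 <= k < (val p).2.+2) alpha r k.

Lemma root_vec_inj (r : nat) : injective (@root_vec r).
Proof.
have E (p : posroot r) (k : 'I_r) :
    root_vec p k 0 = ((val p).1 <= k <= (val p).2)%N%:R.
  rewrite /root_vec summxE.
  under eq_bigr do rewrite mxE.
  case: (boolP (_ <= _ <= _)%N) => [kp|kp].
    rewrite (bigD1_seq k.+1) ?iota_uniq ?mem_index_iota //= eqxx big1 ?addr0 //.
    by move=> i; rewrite eq_sym => /negbTE ->.
  rewrite big_nat_cond big1 // => i; rewrite andbT => ip.
  by case: eqP => // ki; move: kp; rewrite -ltnS -(ltnS k) ki ip.
move=> p q pq; apply/val_inj.
have {}pq (k : 'I_r) : ((val p).1 <= k <= (val p).2)%N = ((val q).1 <= k <= (val q).2)%N.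
  have := congr1 (fun v : 'cV_r => v k 0) pq; rewrite !E => /eqP.
  by do 2!case: (_ <= _ <= _)%N; rewrite ?oner_eq0 // eq_sym oner_eq0.
have := valP p; have := valP q; case: (val p) (val q) pq => [a b] [c d] /= pq cd ab.
have := pq a; rewrite leqnn ab => /esym/andP[ca ad].
have := pq b; rewrite leqnn ab => /esym/andP[cb bd].
have := pq c; rewrite leqnn cd => /andP[ac _].
have := pq d; rewrite leqnn cd => /andP[_ db].
by congr pair; apply/val_inj/anti_leq; rewrite ?ca ?ac ?bd ?db.
Qed.

Definition varpi (r i : nat) : 'cV[rat]_r :=
  ((r.+1%:R - i%:R) / r.+1%:R) *: (\sum_(1 <= k < i) k%:R *: alpha r k)
  + (i%:R / r.+1%:R)
      *: (\sum_(i <= k < r.+1) (r.+1%:R - k%:R) *: alpha r k).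

Definition rho (r : nat) : 'cV[rat]_r := \sum_(1 <= i < r.+1) varpi r i.

(* The column of index k holds the image of the k-th simple root. *)
Definition refl (r i : nat) : 'M[rat]_r :=
  \matrix_(a < r, k < r)
    (let j := k.+1 in
     if j == i then - alpha r i
     else if (j == i.+1) || (j.+1 == i) then alpha r i + alpha r j
     else alpha r j) a 0.

Lemma refl_alpha (r i j : nat) : (1 <= j <= r)%N ->
  refl r i *m alpha r j =
    if j == i then - alpha r i
    else if (j == i.+1) || (j.+1 == i) then alpha r i + alpha r j
    else alpha r j.
Proof.
case: j => // j /= jr; apply/colP => a; rewrite mxE (bigD1 (Ordinal jr)) //=.
rewrite !mxE eqxx mulr1 big1 ?addr0 // => k kj; rewrite [X in _ * X]mxE eqSS.
by rewrite (_ : (k == j :> nat) = false) ?mulr0 //; apply/negbTE.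
Qed.

(* Closure under inverses is automatic, the reflections being involutions. *)
Inductive weyl (r : nat) : 'M[rat]_r -> Prop :=
| weyl_id : weyl 1%:M
| weyl_refl (i : nat) (w : 'M[rat]_r) :
    (1 <= i <= r)%N -> weyl w -> weyl (refl r i *m w).

Definition partitions (r : nat) (xi : 'cV[rat]_r) : set {ffun posroot r -> nat} :=
  [set c | \sum_p (c p)%:R *: root_vec p = xi].

(* [fset_set] is the empty set on infinite sets; see [partitions_finite]. *)
Definition kostant (r : nat) (xi : 'cV[rat]_r) : nat :=
  #|` fset_set (partitions xi)|%fset.

Definition alternation_set (r : nat) (lambda mu : 'cV[rat]_r) : set 'M[rat]_r :=
  [set w | weyl w /\ (0 < kostant (w *m (lambda + rho r) - (mu + rho r)))%N].

Lemma partitions_finite (r : nat) (xi : 'cV[rat]_r) : finite_set (partitions xi).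
Proof.
have root_ge0 (p : posroot r) k : 0 <= root_vec p k 0.
  rewrite /root_vec summxE; apply: sumr_ge0 => i _; rewrite mxE; exact: ler0n.
have root_ge1 (p : posroot r) : 1 <= root_vec p (val p).1 0.
  rewrite /root_vec summxE big_ltn; last by rewrite !ltnS (valP p).
  rewrite mxE eqxx lerDl; apply: sumr_ge0 => i _; rewrite mxE; exact: ler0n.
pose N := \max_(k < r) Num.bound `|xi k 0|%R.
pose B : set {ffun posroot r -> nat} :=
  [set [ffun p => val (f p)] | f in [set: {ffun posroot r -> 'I_N.+1}]].
apply: (@sub_finite_set _ _ B); last exact/finite_image/finite_finset.
move=> c /= cxi.
have cN p : (c p < N.+1)%N.
  rewrite ltnS; apply: leq_trans (leq_bigmax (val p).1).
  rewrite -(ler_nat rat).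
  have le_xi : (c p)%:R <= xi (val p).1 0 :> rat.
    rewrite -cxi summxE (bigD1 p) //= mxE.
    apply: le_trans (_ : (c p)%:R * root_vec p (val p).1 0 <= _).
      by rewrite ler_peMr.
    by rewrite lerDl; apply: sumr_ge0 => q _; rewrite mxE mulr_ge0.
  apply: le_trans le_xi _; apply: ltW.
  by apply: le_lt_trans (ler_norm _) _; apply: archi_boundP.
exists [ffun p => Ordinal (cN p)] => //.
by apply/ffunP => p; rewrite !ffunE.
Qed.

(* Main.v *)
Require Import Defs.
From mathcomp Require Import all_boot all_order all_algebra all_fingroup finmap.
From mathcomp Require Import all_classical.
From mathcomp Require Import zify ring lra.

Import Order.TTheory GRing.Theory Num.Theory.
Local Open Scope classical_set_scope.
Local Open Scope ring_scope.

(** In epsilon coordinates the Weyl group permutes the r + 1 entries, simple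
    root coordinates are partial sums, and a vector has a positive partition
    function when these partial sums are natural numbers.  When d = 0, lambda
    + rho = (l + r, r - 1, ..., 0) and mu + rho have the same total.  The first
    partial sum forces the entry l + r to stay in front; the k-th one then says
    that the permutation may lower the sum of the first k entries by at most
    the size of the tail of the partition mu after k rows.  If mu has at most
    q rows, this tail vanishes for k >= q, so the permutation fixes every
    position past the q-th, and a finite check remains. *)

(** * Coordinates of roots and positivity of the partition function *)

Lemma sum_alphaE (r a b : nat) (c : nat -> rat) (k : 'I_r) :
  (\sum_(a <= i < b) c i *: alpha r i) k 0
    = if (a <= k.+1 < b)%N then c k.+1 else 0.
Proof.
rewrite summxE; under eq_bigr do rewrite !mxE.
case: ifPn => kab; last first.
  rewrite big_nat_cond big1 // => i; rewrite andbT => iab.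
  by case: eqP => [ki|]; rewrite ?mulr0 //; move: kab; rewrite ki iab.
rewrite (bigD1_seq k.+1) ?iota_uniq ?mem_index_iota //= eqxx mulr1 big1 ?addr0 //.
by move=> i; rewrite eq_sym => /negbTE ->; rewrite mulr0.
Qed.

Lemma root_vecE (r : nat) (p : posroot r) (k : 'I_r) :
  root_vec p k 0 = ((val p).1 <= k <= (val p).2)%N%:R.
Proof.
rewrite /root_vec; under eq_bigr do rewrite -[alpha _ _]scale1r.
by rewrite (sum_alphaE _ _ _ (fun=> 1)) !ltnS; case: ifP.
Qed.

(** A partition writes [xi] as a combination of roots with natural coefficients, and roots have
    coordinates 0 or 1. *)
Lemma kostant_gt0_ge0 (r : nat) (xi : 'cV[rat]_r) :
  (0 < kostant xi)%N -> forall k, 0 <= xi k 0.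
Proof.
rewrite /kostant cardfs_gt0 => /fset0Pn [c].
rewrite in_fset_set; last exact: partitions_finite.
rewrite inE => /= <- k; rewrite summxE; apply: sumr_ge0 => p _.
by rewrite mxE root_vecE mulr_ge0 // ler0n.
Qed.

(** Simple roots alone suffice: take [f k] copies of the root [(k, k)]. *)
Lemma kostant_nat_gt0 (r : nat) (xi : 'cV[rat]_r) (f : 'I_r -> nat) :
  (forall k, xi k 0 = (f k)%:R) -> (0 < kostant xi)%N.
Proof.
move=> xif; rewrite /kostant cardfs_gt0; apply/fset0Pn.
exists [ffun p : posroot r =>
  if (val p).1 == (val p).2 then f (val p).1 else 0%N].
rewrite in_fset_set; last exact: partitions_finite.
rewrite inE; apply/colP => k; rewrite summxE xif.
pose pk : posroot r := exist _ (k, k) (leqnn k).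
rewrite (bigD1 pk) //= mxE root_vecE ffunE /= eqxx leqnn mulr1 big1 ?addr0 //.
move=> p ppk; rewrite mxE root_vecE ffunE.
case: eqP => [e|_]; last by rewrite mul0r.
rewrite -e -eqn_leq; case: eqP => [e'|_]; last by rewrite mulr0.
case/eqP: ppk; apply/val_inj; rewrite /= [val p]surjective_pairing -e.
by congr (_, _); apply/val_inj.
Qed.

(** * Passage between simple root and epsilon coordinates *)

(* With alpha_i = epsilon_i - epsilon_(i+1), [eps] passes from simple root
   coordinates to epsilon coordinates and [psum] back, by partial sums. *)
Definition eps (r : nat) : 'M[rat]_(r.+1, r) :=
  \matrix_(j, k) ((j == k :> nat)%:R - (j == k.+1 :> nat)%:R).

Definition psum (r : nat) : 'M[rat]_(r, r.+1) :=
  \matrix_(k, j) (j <= k)%N%:R.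

Lemma sum_ord_delta (n j : nat) (F : nat -> rat) :
  \sum_(k < n) (j == k)%:R * F k = if (j < n)%N then F j else 0.
Proof.
case: ltnP => [jn|nj].
  rewrite (bigD1 (Ordinal jn)) //= eqxx mul1r big1 ?addr0 // => k kj.
  by rewrite eq_sym (_ : _ == _ = false) ?mul0r //; apply/negbTE.
rewrite big1 // => k _; rewrite (_ : _ == _ = false) ?mul0r //.
by have := ltn_ord k; lia.
Qed.

(** The function [f] extends the coordinates of [v] by zero at both ends, so that one difference
    formula covers all r + 1 entries, the first and last included. *)
Lemma eps_mulE (r : nat) (v : 'cV[rat]_r) (f : nat -> rat) :
  f 0%N = 0 -> f r.+1 = 0 -> (forall k, v k 0 = f k.+1) ->
  forall j, (eps r *m v) j 0 = f j.+1 - f j.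
Proof.
move=> f0 fr vf j; rewrite mxE.
under eq_bigr do rewrite mxE vf mulrBl.
rewrite sumrB (sum_ord_delta _ _ (fun k => f k.+1)); congr (_ - _).
  case: ltnP => // rj; have -> : j = r :> nat by have := ltn_ord j; lia.
  by rewrite fr.
case: (nat_of_ord j) (ltn_ord j) => [|i] ir.
  by rewrite f0 big1 // => k _; rewrite mul0r.
under eq_bigr do rewrite eqSS.
by rewrite (sum_ord_delta _ _ (fun k => f k.+1)) -ltnS ir.
Qed.

Lemma psum_eps (r : nat) : psum r *m eps r = 1%:M.
Proof.
apply/matrixP => a b; rewrite !mxE.
under eq_bigr do rewrite !mxE mulrBr mulrC [X in _ - X]mulrC.
rewrite sumrB.
under eq_bigr do rewrite eq_sym.
under [X in _ - X]eq_bigr do rewrite eq_sym.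
rewrite (sum_ord_delta _ _ (fun j => (j <= a)%N%:R)).
rewrite (sum_ord_delta _ _ (fun j => (j <= a)%N%:R)).
rewrite ltnS (ltnW (ltn_ord b)) ltnS ltn_ord -val_eqE /=.
by case: ltngtP; rewrite ?subrr ?subr0.
Qed.

Lemma eps_inj (r p : nat) : injective (mulmx (eps r) : 'M_(r, p) -> _).
Proof. by apply: (can_inj (g := mulmx (psum r))) => v; rewrite mulmxA psum_eps mul1mx. Qed.

Lemma eps_alpha (r i : nat) (j : 'I_r.+1) : (1 <= i <= r)%N ->
  (eps r *m alpha r i) j 0 = (j.+1 == i)%:R - (j == i :> nat)%:R.
Proof.
move=> ir; rewrite (@eps_mulE _ _ (fun k => (k == i)%:R)) //.
- by rewrite (_ : _ == _ = false) //; lia.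
- by rewrite (_ : _ == _ = false) //; lia.
- by move=> k; rewrite mxE.
Qed.

(** * Simple reflections as adjacent transpositions *)

Lemma val_tperm (n : nat) (a b x : 'I_n) :
  tperm a b x = (if x == a :> nat then nat_of_ord b else if x == b :> nat then nat_of_ord a else nat_of_ord x) :> nat.
Proof.
by case: tpermP => [->|->|/eqP xa /eqP xb]; rewrite ?eqxx //;
  [case: eqP => // -> | rewrite !val_eqE (negbTE xa) (negbTE xb)].
Qed.

(** The action of s_i on epsilon coordinates: it swaps the i-th and the (i + 1)-st, which sit at
    positions i - 1 and i counted from 0. *)
Definition adj (r i : nat) : 'S_r.+1 := tperm (inord i.-1) (inord i).

Lemma val_adj (r i : nat) (x : 'I_r.+1) : (1 <= i <= r)%N ->
  adj r i x = (if x.+1 == i then i else if x == i :> nat then i.-1 else x) :> nat.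
Proof.
case: i => // i /andP[_ ir].
by rewrite val_tperm !inordK /= ?eqSS //; lia.
Qed.

(** Both sides are compared column by column: column k is the image of alpha_(k+1), and swapping two
    entries of epsilon_(k+1) - epsilon_(k+2) reproduces each case of [refl_alpha]. *)
Lemma eps_refl (r i : nat) : (1 <= i <= r)%N ->
  eps r *m refl r i = perm_mx (adj r i) *m eps r.
Proof.
move=> ir; rewrite -row_permE; apply/matrixP => j k.
have kr := ltn_ord k.
have alphaE : alpha r k.+1 = delta_mx k 0.
  by apply/colP => a; rewrite !mxE eqSS andbT.
transitivity ((eps r *m (refl r i *m alpha r k.+1)) j 0).
  by rewrite alphaE mulmxA -colE [RHS]mxE.
transitivity ((eps r *m alpha r k.+1) (adj r i j) 0); last first.
  by rewrite alphaE -colE !mxE.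
rewrite eps_alpha // val_adj // refl_alpha //.
have jr := ltn_ord j.
case: (eqVneq k.+1 i) => [ki|ki].
  rewrite mulmxN mxE eps_alpha // -ki !eqSS.
  by do 2?[case: ifP => ?]; do ![case: eqP => ? //=]; try (exfalso; lia); lra.
case: ifPn => kii.
  rewrite mulmxDr mxE !eps_alpha //.
  by do 2?[case: ifP => ?]; do ![case: eqP => ? //=]; try (exfalso; lia); lra.
rewrite eps_alpha //.
by do 2?[case: ifP => ?]; do ![case: eqP => ? //=]; try (exfalso; lia); lra.
Qed.

(** Induction on a product of reflections, each moved across [eps] by [eps_refl]. *)
Lemma weyl_perm (r : nat) (w : 'M[rat]_r) : weyl w ->
  exists s : 'S_r.+1, eps r *m w = perm_mx s *m eps r.
Proof.
elim=> [|i {}w ir _ [s es]]; first by exists 1%g; rewrite perm_mx1 mulmx1 mul1mx.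
exists (adj r i * s)%g.
by rewrite perm_mxM mulmxA eps_refl // -!mulmxA es.
Qed.

(** * Weights in epsilon coordinates *)

(** These are the entries of the inverse Cartan matrix; the two ranges of the definition merge into
    one formula. *)
Lemma varpiE (r i : nat) (k : 'I_r) : (i <= r)%N ->
  varpi r i k 0 = (minn i k.+1)%:R - i%:R * k.+1%:R / r.+1%:R.
Proof.
move=> ir; have kr : (k.+1 < r.+1)%N := ltn_ord k.
have n0 : r.+1%:R != 0 :> rat by rewrite pnatr_eq0.
rewrite /varpi !mxE.
rewrite (sum_alphaE _ _ _ (fun k => k%:R)).
rewrite (sum_alphaE _ _ _ (fun k => r.+1%:R - k%:R)) kr andbT /=.
case: (leqP i k.+1) => ik.
  by rewrite mulr0 add0r; move: (r.+1%:R) n0 => n n0; field.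
by rewrite mulr0 addr0; move: (r.+1%:R) n0 => n n0; field.
Qed.

(** Consecutive differences of [minn i j] give i ones followed by zeros; the linear term contributes
    the shift by i / (r + 1), which makes the entries sum to 0. *)
Lemma eps_varpi (r i : nat) (j : 'I_r.+1) : (i <= r)%N ->
  (eps r *m varpi r i) j 0 = (j < i)%N%:R - i%:R / r.+1%:R.
Proof.
move=> ir; have n0 : r.+1%:R != 0 :> rat by rewrite pnatr_eq0.
rewrite (@eps_mulE _ _ (fun k => (minn i k)%:R - i%:R * k%:R / r.+1%:R)).
- have -> : minn i j.+1 = (minn i j + (j < i))%N by lia.
  by rewrite natrD -natr1; move: (r.+1%:R) n0 => n n0; field.
- by rewrite minn0 mulr0 mul0r subrr.
- by rewrite (minn_idPl _) ?mulfK ?subrr // ltnW.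
- by move=> k; rewrite varpiE.
Qed.

(** For natural [c], the first sum is the row of index j, counted from 0, of the partition with
    [c i] columns of height i; the second is its size. *)
Lemma eps_sum_varpi (r : nat) (c : nat -> rat) (j : 'I_r.+1) :
  (eps r *m \sum_(1 <= i < r.+1) c i *: varpi r i) j 0
    = \sum_(1 <= i < r.+1) c i * (j < i)%N%:R
      - (\sum_(1 <= i < r.+1) c i * i%:R) / r.+1%:R.
Proof.
rewrite mulmx_sumr summxE mulr_suml -sumrB; apply: eq_big_nat => i ir.
by rewrite -scalemxAr mxE eps_varpi ?mulrBr ?mulrA //; lia.
Qed.

Lemma sum_nat_gt (r j : nat) : (j <= r)%N ->
  (\sum_(1 <= i < r.+1) (j < i) = r - j)%N.
Proof.
elim: r => [|r IH] jr; first by rewrite big_nil.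
rewrite big_nat_recr //=.
case: (ltngtP j r.+1) jr => // [jr _|-> _]; first by rewrite IH //; lia.
rewrite big_nat_cond big1; lia.
Qed.

Lemma eps_rho (r : nat) (j : 'I_r.+1) :
  (eps r *m rho r) j 0
    = r%:R - j%:R - (\sum_(1 <= i < r.+1) i%:R) / r.+1%:R.
Proof.
rewrite /rho; under eq_bigr do rewrite -[varpi _ _]scale1r.
rewrite (eps_sum_varpi _ (fun=> 1)).
under eq_bigr do rewrite mul1r.
under [X in _ - X / _]eq_bigr do rewrite mul1r.
by rewrite -natr_sum sum_nat_gt ?natrB // -ltnS.
Qed.

(** * Membership as inequalities on a permutation *)

(** The summand is entry j in epsilon coordinates. Position j receives entry [s j] of lambda + rho;
    the constant shift of rho is invariant under permutation and cancels, and the shifts of lambda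
    and mu leave d / (r + 1). *)
Lemma weight_diffE (r l : nat) (m : nat -> nat) (w : 'M[rat]_r) (s : 'S_r.+1)
    (k : 'I_r) :
  eps r *m w = perm_mx s *m eps r ->
  (w *m (l%:R *: varpi r 1 + rho r)
     - (\sum_(1 <= i < r.+1) (m i)%:R *: varpi r i + rho r)) k 0
  = \sum_(j < r.+1 | (j <= k)%N)
      (l%:R * (s j == 0%N :> nat)%:R + (j%:R - (s j)%:R)
       - \sum_(1 <= i < r.+1) (m i)%:R * (j < i)%N%:R
       - (l%:R - \sum_(1 <= i < r.+1) (m i)%:R * i%:R) / r.+1%:R) :> rat.
Proof.
move=> ws; set x := _ - _.
have -> : x = psum r *m (eps r *m x) by rewrite mulmxA psum_eps mul1mx.
rewrite mxE [RHS]big_mkcond /=; apply: eq_bigr => j _; rewrite mxE.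
case: ifP => _; last by rewrite mul0r.
have r1 : (1 <= r)%N by case: (r) k => [[]|].
have DE (u v : 'cV[rat]_r.+1) i : (u + v) i 0 = u i 0 + v i 0 by rewrite mxE.
have NE (u : 'cV[rat]_r.+1) i : (- u) i 0 = - u i 0 by rewrite mxE.
have ZE c (u : 'cV[rat]_r.+1) i : (c *: u) i 0 = c * u i 0 by rewrite mxE.
have PE (u : 'cV[rat]_r.+1) i : (row_perm s u) i 0 = u (s i) 0 by rewrite mxE.
rewrite mul1r mulmxBr mulmxA ws -mulmxA -row_permE !mulmxDr -scalemxAr.
rewrite DE PE NE !DE ZE eps_sum_varpi !eps_rho eps_varpi //.
have n0 : r.+1%:R != 0 :> rat by rewrite pnatr_eq0.
by rewrite ltnS leqn0; move: (r.+1%:R) n0 => n n0; field.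
Qed.

Lemma sum_ord_ltn_min (i k : nat) : (\sum_(j < k) (j < i) = minn i k)%N.
Proof.
elim: k => [|k IH]; first by rewrite big_ord0 minn0.
by rewrite big_ord_recr IH /=; lia.
Qed.

Lemma sum_widen_inord (R : nmodType) (r k : nat) (F : 'I_r.+1 -> R) :
  (k < r.+1)%N ->
  \sum_(j < r.+1 | (j <= k)%N) F j = \sum_(j < k.+1) F (inord j).
Proof.
move=> kr; rewrite (big_ord_widen _ (fun j => F (inord j)) kr).
by apply: eq_bigr => j _; rewrite inord_val.
Qed.

(** When d = 0 the shift d / (r + 1) vanishes and the coordinates are integers, so the necessary
    condition [kostant_gt0_ge0] and the sufficient one [kostant_nat_gt0] meet. With truncated
    subtraction, the sum of [m i * (i - k.+1)] is the size of mu below its first k + 1 rows. *)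
Lemma kostant_perm_gt0 (r l : nat) (m : nat -> nat) (w : 'M[rat]_r)
    (s : 'S_r.+1) :
  (1 <= r)%N -> l = (\sum_(1 <= i < r.+1) m i * i)%N ->
  eps r *m w = perm_mx s *m eps r ->
  (0 < kostant (w *m (l%:R *: varpi r 1 + rho r)
     - (\sum_(1 <= i < r.+1) (m i)%:R *: varpi r i + rho r)))%N
  <-> s ord0 = ord0 /\ forall k, (k < r)%N ->
    (\sum_(j < k.+1) s (inord j)
       <= \sum_(1 <= i < r.+1) m i * (i - k.+1) + \sum_(j < k.+1) j)%N.
Proof.
move=> r1 lE ws; set x := _ - _.
have xE (k : 'I_r) : x k 0 = \sum_(j < k.+1)
    (l%:R * (s (inord j) == 0%N :> nat)%:R + (j%:R - (s (inord j))%:R)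
     - \sum_(1 <= i < r.+1) (m i)%:R * (j < i)%N%:R).
  have kr := ltn_ord k.
  rewrite /x (weight_diffE _ _ _ _ _ _ ws) sum_widen_inord; last exact: ltnW.
  apply: eq_bigr => j _; rewrite inordK; last by have := ltn_ord j; lia.
  rewrite lE natr_sum; under [X in _ - (X - _) / _]eq_bigr do rewrite natrM.
  by rewrite subrr mul0r subr0.
have {}xE (k : 'I_r) : s ord0 = ord0 -> x k 0 =
    (\sum_(1 <= i < r.+1) m i * (i - k.+1) + \sum_(j < k.+1) j)%N%:R
    - (\sum_(j < k.+1) s (inord j))%N%:R.
  move=> s0; rewrite xE sumrB big_split sumrB /= natrD !natr_sum.
  (* As [s] fixes 0, only the term j = 0 carries l. *)
  have -> : \sum_(j < k.+1) l%:R * (s (inord j) == 0%N :> nat)%:R = l%:R :> rat.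
    rewrite big_ord_recl big1 /= => [|j _].
      have -> : inord 0 = ord0 :> 'I_r.+1 by apply/val_inj; rewrite /= inordK.
      by rewrite s0 eqxx mulr1 addr0.
    rewrite (_ : _ == _ = false) ?mulr0 //; apply/negbTE/eqP => sj.
    have /perm_inj/(congr1 val) : s (inord (bump 0 j)) = s ord0.
      by rewrite s0; apply/val_inj.
    rewrite /= inordK // /bump; have := ltn_ord j; have := ltn_ord k; lia.
  (* Double counting: a column of height i has [minn i k.+1] cells in the first k + 1 rows. *)
  have -> : \sum_(j < k.+1) \sum_(1 <= i < r.+1) (m i)%:R * (j < i)%N%:R
      = (\sum_(1 <= i < r.+1) m i * minn i k.+1)%N%:R :> rat.
    rewrite exchange_big natr_sum /=; apply: eq_bigr => i _.
    by rewrite -mulr_sumr -natr_sum sum_ord_ltn_min natrM.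
  rewrite -natr_sum.
  (* The size l of mu splits into its first k + 1 rows and the rest. *)
  have -> : l%:R = (\sum_(1 <= i < r.+1) m i * (i - k.+1))%:R
      + (\sum_(1 <= i < r.+1) m i * minn i k.+1)%N%:R :> rat.
    rewrite -natrD -big_split lE; congr _%:R; apply: eq_bigr => i _ /=.
    by rewrite -mulnDr; congr (_ * _)%N; lia.
  by rewrite natr_sum; ring.
split=> [/kostant_gt0_ge0 x0|[s0 le]].
  have s0 : s ord0 = ord0.
    have := x0 (Ordinal r1).
    rewrite /x (weight_diffE _ _ _ _ _ _ ws) sum_widen_inord // big_ord1 /=.
    have -> : inord 0 = ord0 :> 'I_r.+1 by apply/val_inj; rewrite /= inordK.
    rewrite lE natr_sum; under [X in _ - (X - _) / _]eq_bigr do rewrite natrM.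
    rewrite subrr mul0r subr0; case: eqP => [s0 _|/eqP s0].
      exact/val_inj.
    (* If [s] moves 0, the first coordinate is minus [s ord0] minus the first row of mu, hence
       negative. *)
    have : 1 <= (s ord0)%:R :> rat by rewrite ler1n lt0n.
    have : 0 <= \sum_(1 <= i < r.+1) (m i)%:R * (0 < i)%N%:R :> rat.
      by apply: sumr_ge0 => i _; rewrite mulr_ge0 // ler0n.
    by rewrite mulr0 /= => A B C; exfalso; clear -A B C; lra.
  split=> // k kr; have := x0 (Ordinal kr).
  by rewrite xE //= subr_ge0 ler_nat.
apply: (kostant_nat_gt0 _ _ (fun k : 'I_r =>
  (\sum_(1 <= i < r.+1) m i * (i - k.+1) + \sum_(j < k.+1) j
    - \sum_(j < k.+1) s (inord j))%N)) => k.
by rewrite xE // natrB //; apply: le.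
Qed.

(** * Permutations that fix a tail *)

(* A set of k naturals whose sum does not exceed 0 + ... + (k - 1) is the
   initial segment. *)
Lemma perm_stable_initial (n k : nat) (s : 'S_n) :
  (\sum_(j < n | j < k) s j <= \sum_(j < n | j < k) j)%N ->
  forall j, (s j < k)%N = (j < k)%N.
Proof.
move=> le; pose B := [set j : 'I_n | (j < k)%N]%SET; pose A := (s @: B)%SET.
have cA : #|A| = #|B| by rewrite card_imset //; apply: perm_inj.
have sumA : (\sum_(j < n | j < k) s j = \sum_(x in A) x)%N.
  rewrite big_imset /=; last by move=> x y _ _; apply: perm_inj.
  by apply: eq_bigl => j; rewrite inE.
have sumB : (\sum_(j < n | j < k) j = \sum_(x in B) x)%N.
  by apply: eq_bigl => j; rewrite inE.
have cD : #|(A :\: B)%SET| = #|(B :\: A)%SET|.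
  by apply/eqP; rewrite -(eqn_add2l #|(A :&: B)%SET|) cardsID finset.setIC cardsID cA.
move: le; rewrite sumA sumB (big_setID B) [leqRHS](big_setID A) /= finset.setIC.
rewrite leq_add2l => le.
(* The differences A \ B and B \ A are equally large, with elements at least k in the former and
   below k in the latter; since the sum over A \ B is at most that over B \ A, both are empty. *)
have leA : (\sum_(x in (A :\: B)%SET) k <= \sum_(x in (A :\: B)%SET) x)%N.
  by apply: leq_sum => x; rewrite !inE -leqNgt => /andP[].
have leB : (\sum_(x in (B :\: A)%SET) x.+1 <= \sum_(x in (B :\: A)%SET) k)%N.
  by apply: leq_sum => x; rewrite !inE => /andP[].
move: leB; under eq_bigr do rewrite -addn1.
rewrite big_split /= sum1_card sum_nat_const => leB.
move: leA; rewrite sum_nat_const cD => leA.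
have /eqP c0 : #|(A :\: B)%SET| == 0%N.
  rewrite cD -leqn0 -(leq_add2l (#|(B :\: A)%SET| * k)) addn0.
  apply: leq_trans leB; rewrite leq_add2r; exact: leq_trans leA le.
have AB : A = B.
  by apply/eqP; rewrite eqEcard cA leqnn andbT -finset.setD_eq0 -cards_eq0 c0.
move=> j; have : (s j \in A) = (j \in B) by rewrite mem_imset //; apply: perm_inj.
by rewrite AB !inE.
Qed.

(** The inequalities make every initial segment of length at least q stable, and stability at
    lengths j and j + 1 pins [s j]. Conversely, fixing the tail makes these segments stable, so the
    two sums agree by reindexing. *)
Lemma perm_fix_tail (r q : nat) (s : 'S_r.+1) :
  (forall k, (k < r)%N -> (q <= k.+1)%N ->
     (\sum_(j < k.+1) s (inord j) <= \sum_(j < k.+1) j)%N)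
  <-> (forall j : 'I_r.+1, (q <= j)%N -> s j = j).
Proof.
have sumE k : (k < r)%N ->
    ((\sum_(j < k.+1) s (inord j) = \sum_(j < r.+1 | j < k.+1) s j)%N
     * (\sum_(j < k.+1) j = \sum_(j < r.+1 | j < k.+1) j)%N)%type.
  move=> kr; split; last by rewrite (big_ord_widen _ id (leqW kr)).
  rewrite (big_ord_widen _ (fun j => s (inord j) : nat) (leqW kr)).
  by apply: eq_bigr => j _; rewrite inord_val.
split=> [le j qj|fix_s k kr qk].
  have stable k : (q <= k)%N -> forall i, (s i < k)%N = (i < k)%N.
    (* A segment longer than r is everything. *)
    case: (leqP r.+1 k) => [rk _ i|kr qk]; first by have := ltn_ord i; have := ltn_ord (s i); lia.
    apply: perm_stable_initial; case: k => [|k] in kr qk *; first by rewrite !big_pred0_eq.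
    by rewrite -!sumE //; apply: le.
  by apply/val_inj; have := stable j qj j; have := stable j.+1 (leqW qj) j; rewrite /=; lia.
rewrite !sumE // [leqRHS](reindex_inj (@perm_inj _ s)) /=.
rewrite (eq_bigl (fun j => (s j < k.+1)%N)) // => j.
case: (leqP q j) => [qj|jq]; first by rewrite fix_s.
case: (leqP q (s j)) => [qsj|sjq]; last by lia.
by have /perm_inj sj := fix_s _ qsj; move: qsj; rewrite sj leqNgt jq.
Qed.

(** If mu has at most q rows, nothing of it lies below row k + 1 once q <= k + 1; there
    [perm_fix_tail] trades the inequalities for fixed points, leaving only k + 1 < q to check. *)
Lemma alternation_perm (r q l : nat) (m : nat -> nat) (w : 'M[rat]_r)
    (s : 'S_r.+1) :
  (1 <= r)%N -> l = (\sum_(1 <= i < r.+1) m i * i)%N ->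
  (forall j, (q.+1 <= j <= r)%N -> m j = 0%N) ->
  eps r *m w = perm_mx s *m eps r ->
  (0 < kostant (w *m (l%:R *: varpi r 1 + rho r)
     - (\sum_(1 <= i < r.+1) (m i)%:R *: varpi r i + rho r)))%N
  <-> [/\ s ord0 = ord0, forall j : 'I_r.+1, (q <= j)%N -> s j = j
    & forall k, (k < r)%N -> (k.+1 < q)%N ->
    (\sum_(j < k.+1) s (inord j)
       <= \sum_(1 <= i < r.+1) m i * (i - k.+1) + \sum_(j < k.+1) j)%N].
Proof.
move=> r1 lE mq ws; rewrite (kostant_perm_gt0 _ _ _ _ _ r1 lE ws).
have M0 k : (q <= k.+1)%N -> (\sum_(1 <= i < r.+1) m i * (i - k.+1) = 0)%N.
  move=> qk; rewrite big_nat_cond big1 // => i /andP[/andP[_ ir] _].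
  case: (leqP i q) => iq; last by rewrite mq ?iq.
  by rewrite (_ : (i - _ = 0)%N) ?muln0 //; lia.
split=> [[s0 le]|[s0 /perm_fix_tail fix_s le]].
  split=> // [|k kr _]; last exact: le.
  by apply/perm_fix_tail => k kr qk; have := le k kr; rewrite M0.
split=> // k kr; case: (leqP q k.+1) => qk; last exact: le.
by rewrite M0 //; apply: fix_s.
Qed.

(** * The reflection s_1 is excluded *)

(** The first coordinate is -1 - M - (l - N) / (r + 1), with M the sum of the [m i] and N that of
    the [m i * i]. Since N <= M (r + 1), it is at most -1. *)
Lemma s1_notin_alternation (r l : nat) (m : nat -> nat) : (1 <= r)%N ->
  ~ alternation_set (l%:R *: varpi r 1%N)
      (\sum_(1 <= i < r.+1) (m i)%:R *: varpi r i) (refl r 1%N).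
Proof.
move=> r1 [_ /kostant_gt0_ge0 /(_ (Ordinal r1))].
rewrite (weight_diffE _ _ _ _ _ _ (eps_refl _ _ _)) // sum_widen_inord // big_ord1.
rewrite val_adj // inordK //= mulr0 add0r sub0r.
rewrite (eq_big_nat _ _ (F2 := fun i => (m i)%:R)); last first.
  by move=> i /andP[-> _]; rewrite mulr1.
set M := \sum_(1 <= i < r.+1) (m i)%:R.
set N := \sum_(1 <= i < r.+1) _.
have NM : N <= M * r.+1%:R.
  rewrite /M mulr_suml; apply: ler_sum_nat => i /andP[_ ir].
  by rewrite ler_wpM2l ?ler0n // ler_nat ltnW.
have : - ((l%:R - N) / r.+1%:R) <= M.
  rewrite -mulNr opprB ler_pdivrMr ?ltr0n //.
  by apply: le_trans NM; rewrite gerBl ler0n.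
have aux (a b : rat) : - a <= b -> 0 <= -1 - b - a -> False by move=> *; lra.
exact: aux.
Qed.

(** * Permutations of the first few positions *)

Lemma perm_eq_initial (r q : nat) (s t : 'S_r.+1) :
  (forall j : 'I_r.+1, (q <= j)%N -> s j = j) ->
  (forall j : 'I_r.+1, (q <= j)%N -> t j = j) ->
  (forall i, (i < q)%N -> (i < r.+1)%N -> s (inord i) = t (inord i) :> nat) ->
  s = t.
Proof.
move=> fs ft st; apply/permP => j; case: (leqP q j) => [qj|jq].
  by rewrite fs ?ft.
by apply/val_inj; have := st j jq (ltn_ord j); rewrite inord_val.
Qed.

Lemma perm_inord_neq (r i j : nat) (s : 'S_r.+1) :
  (i < r.+1)%N -> (j < r.+1)%N -> i != j -> s (inord i) != s (inord j) :> nat.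
Proof.
move=> ir jr; apply: contra => /eqP sij; apply/eqP.
by have /perm_inj/(congr1 val) := val_inj sij; rewrite /= !inordK.
Qed.

Lemma perm_inord_lt (r q i : nat) (s : 'S_r.+1) :
  (forall j : 'I_r.+1, (q <= j)%N -> s j = j) ->
  (i < q)%N -> (i < r.+1)%N -> (s (inord i) < q)%N.
Proof.
move=> fs iq ir; rewrite ltnNge; apply/negP => qs.
by have /perm_inj sj := fs _ qs; move: qs; rewrite sj inordK // leqNgt iq.
Qed.

(** A form of s({1, 2, 3}) = {1, 2, 3} that linear arithmetic on naturals can exploit. *)
Lemma perm_inord123 (r : nat) (s : 'S_r.+1) :
  (3 <= r)%N -> s (inord 0) = 0%N :> nat ->
  (forall j : 'I_r.+1, (4 <= j)%N -> s j = j) ->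
  [&& (0 < s (inord 1) < 4)%N, (0 < s (inord 2) < 4)%N, (0 < s (inord 3) < 4)%N,
      s (inord 1) != s (inord 2) :> nat, s (inord 1) != s (inord 3) :> nat
    & s (inord 2) != s (inord 3) :> nat].
Proof.
move=> r3 s0 fs.
have lt4 i : (i < 4)%N -> (s (inord i) < 4)%N.
  by move=> i4; apply: (perm_inord_lt _ _ _ _ fs) => //; lia.
have neq i j : (i < 4)%N -> (j < 4)%N -> i != j ->
    s (inord i) != s (inord j) :> nat.
  by move=> i4 j4; apply: perm_inord_neq; lia.
have pos i : (0 < i < 4)%N -> (0 < s (inord i))%N.
  by case/andP=> i0 i4; rewrite lt0n -s0 neq // -lt0n.
by rewrite !pos ?lt4 ?neq.
Qed.

Lemma eps_perm_inj (r : nat) (w w' : 'M[rat]_r) (s : 'S_r.+1) :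
  eps r *m w = perm_mx s *m eps r -> eps r *m w' = perm_mx s *m eps r -> w = w'.
Proof. by move=> ws ws'; apply: eps_inj; rewrite ws ws'. Qed.

(** Permutations compose from left to right, so the order of the factors is kept. *)
Lemma eps_perm_mul (r : nat) (w w' : 'M[rat]_r) (s s' : 'S_r.+1) :
  eps r *m w = perm_mx s *m eps r -> eps r *m w' = perm_mx s' *m eps r ->
  eps r *m (w *m w') = perm_mx (s * s')%g *m eps r.
Proof. by move=> ws ws'; rewrite mulmxA ws -mulmxA ws' mulmxA perm_mxM. Qed.

Lemma eps_perm1 (r : nat) : eps r *m 1%:M = perm_mx 1%g *m eps r.
Proof. by rewrite perm_mx1 mulmx1 mul1mx. Qed.

Lemma weyl_refl1 (r i : nat) : (1 <= i <= r)%N -> weyl (refl r i).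
Proof. by move=> ir; rewrite -[refl r i]mulmx1; apply/weyl_refl/weyl_id. Qed.

(** * Partitions mu with at most three rows *)

(** With q = 2 every position except 1 is fixed, hence 1 is fixed too. *)
Lemma alternation_eq_id (r l : nat) (m : nat -> nat) :
  (1 <= r)%N -> l = (\sum_(1 <= i < r.+1) m i * i)%N ->
  (forall j, (3 <= j <= r)%N -> m j = 0%N) ->
  alternation_set (l%:R *: varpi r 1%N)
    (\sum_(1 <= i < r.+1) (m i)%:R *: varpi r i) = [set 1%:M].
Proof.
move=> r1 lE m0; apply/seteqP; split=> [w [/weyl_perm[s ws]]|_ ->]; last first.
  split; first exact: weyl_id.
  apply/(alternation_perm _ _ _ _ _ _ r1 lE m0 (eps_perm1 r)); split.
  - by rewrite perm1.
  - by move=> j; rewrite perm1.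
  - by case=> // _ _; rewrite !big_ord1 perm1 inordK.
move=> /(alternation_perm _ _ _ _ _ _ r1 lE m0 ws) [s0 fs _].
have i0 : inord 0%N = ord0 :> 'I_r.+1 by apply/val_inj; rewrite /= inordK.
suff s1 : s = 1%g by apply: eps_perm_inj ws _; rewrite s1; apply: eps_perm1.
apply: (perm_eq_initial _ _ _ _ fs) => [j|]; first by rewrite perm1.
have := perm_inord_lt _ _ 1%N s fs isT r1; have := perm_inord_neq _ 1%N 0%N s r1 isT isT.
rewrite i0 s0 /= => n1 l1.
by case=> [|[|//]] _ ir; rewrite perm1 ?i0 ?s0 // inordK //; lia.
Qed.

(** With q = 3 only positions 1 and 2 can move, which leaves the identity and s_2; it remains to see
    that both satisfy the inequalities. *)
Lemma alternation_eq_s2 (r l : nat) (m : nat -> nat) :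
  (3 <= r)%N -> l = (\sum_(1 <= i < r.+1) m i * i)%N ->
  (forall j, (4 <= j <= r)%N -> m j = 0%N) -> m 3%N <> 0%N ->
  alternation_set (l%:R *: varpi r 1%N)
    (\sum_(1 <= i < r.+1) (m i)%:R *: varpi r i) = [set 1%:M; refl r 2%N].
Proof.
move=> r3 lE m0 m3.
have r1 : (1 <= r)%N by lia.
have i0 : inord 0%N = ord0 :> 'I_r.+1 by apply/val_inj; rewrite /= inordK.
have r2 : (1 <= 2 <= r)%N by lia.
(* The reflection s_2 raises the sum of the first two values by 1; the third row of mu, nonempty as
   [m 3] is nonzero, allows it. *)
have M1 : (1 <= \sum_(1 <= i < r.+1) m i * (i - 2))%N.
  rewrite (bigD1_seq 3%N) ?iota_uniq ?mem_index_iota /=; lia.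
apply/seteqP; split=> [w [/weyl_perm[s ws]]|_ [->|->]]; last 2 first.
- split; first exact: weyl_id.
  apply/(alternation_perm _ _ _ _ _ _ r1 lE m0 (eps_perm1 r)); split.
  - by rewrite perm1.
  - by move=> j; rewrite perm1.
  - case=> [|[|//]] _ _; rewrite !big_ord_recr !big_ord0 /= !perm1 !inordK //; lia.
- split; first exact: weyl_refl1.
  apply/(alternation_perm _ _ _ _ _ _ r1 lE m0 (eps_refl _ _ r2)); split.
  - by apply/val_inj; rewrite /= val_adj.
  - by move=> j j3; apply/val_inj; rewrite /= val_adj //; do 2?case: eqP; lia.
  - case=> [|[|//]] _ _; rewrite !big_ord_recr !big_ord0 /= !val_adj // !inordK //=; lia.
move=> /(alternation_perm _ _ _ _ _ _ r1 lE m0 ws) [s0 fs _].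
have l1 := perm_inord_lt _ _ 1%N s fs isT r1.
have l2 : (s (inord 2%N) < 3)%N by apply: (perm_inord_lt _ _ _ _ fs) => //; lia.
have n1 : s (inord 1%N) != s (inord 0%N) :> nat by apply: perm_inord_neq; lia.
have n2 : s (inord 2%N) != s (inord 0%N) :> nat by apply: perm_inord_neq; lia.
have n12 : s (inord 1%N) != s (inord 2%N) :> nat by apply: perm_inord_neq; lia.
rewrite i0 s0 in n1 n2.
have [s1|s1] : (s (inord 1%N) = 1 :> nat \/ s (inord 1%N) = 2 :> nat)%N.
  by move: n1 l1 => /=; lia.
- left; suff s1' : s = 1%g by apply: eps_perm_inj ws _; rewrite s1'; apply: eps_perm1.
  apply: (perm_eq_initial _ _ _ _ fs) => [j|]; first by rewrite perm1.
  case=> [|[|[|//]]] _ ir; rewrite perm1 ?i0 ?s0 // inordK // ; move: n2 => /=; lia.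
- right; suff s1' : s = adj r 2%N by apply: eps_perm_inj ws _; rewrite s1'; apply: eps_refl.
  apply: (perm_eq_initial _ _ _ _ fs) => [j j3|].
    by apply/val_inj; rewrite /= val_adj //; do 2?case: eqP; lia.
  case=> [|[|[|//]]] _ ir; rewrite val_adj // inordK //= ?i0 ?s0 //; move: n2 => /=; lia.
Qed.

(** * Partitions mu with exactly four rows *)

(** With q = 4, [s] permutes 1, 2, 3. The inequality on two positions holds because s(1) <= 3 and at
    least two cells of mu lie below row 2. The one on three positions reads s(1) + s(2) <= m_4 + 3,
    where s(1) + s(2) = 6 - s(3). *)
Lemma alternation_perm_le4 (r l : nat) (m : nat -> nat) (w : 'M[rat]_r)
    (s : 'S_r.+1) :
  (4 <= r)%N -> l = (\sum_(1 <= i < r.+1) m i * i)%N ->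
  (forall j, (5 <= j <= r)%N -> m j = 0%N) -> m 4%N <> 0%N -> weyl w ->
  eps r *m w = perm_mx s *m eps r ->
  alternation_set (l%:R *: varpi r 1%N)
    (\sum_(1 <= i < r.+1) (m i)%:R *: varpi r i) w
  <-> [/\ s (inord 0%N) = 0%N :> nat, forall j : 'I_r.+1, (4 <= j)%N -> s j = j
        & (3 <= m 4%N + s (inord 3%N))%N].
Proof.
move=> r4 lE m0 m4 ww ws.
have r1 : (1 <= r)%N by lia.
have i0 : inord 0%N = ord0 :> 'I_r.+1 by apply/val_inj; rewrite /= inordK.
have M1 : (2 <= \sum_(1 <= i < r.+1) m i * (i - 2))%N.
  rewrite (bigD1_seq 4%N) ?iota_uniq ?mem_index_iota /=; lia.
have M2 : (\sum_(1 <= i < r.+1) m i * (i - 3) = m 4%N)%N.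
  rewrite (bigD1_seq 4%N) ?iota_uniq ?mem_index_iota /=; try lia.
  rewrite big_nat_cond big1 ?addn0 ?muln1 // => i /andP[/andP[_ ir] i4].
  case: (ltnP 4 i) => [i5|]; first by rewrite m0 ?i5.
  by rewrite leq_eqVlt (negbTE i4) /= => i3; rewrite (_ : (i - 3 = 0)%N) ?muln0 //; lia.
have s123 : s (inord 0%N) = 0%N :> nat ->
    (forall j : 'I_r.+1, (4 <= j)%N -> s j = j) ->
    (s (inord 1%N) + s (inord 2%N) + s (inord 3%N) = 6 /\ s (inord 1%N) < 4)%N.
  move=> s0 fs.
  have /and5P[l1 l2 l3 n12 /andP[n13 n23]] := perm_inord123 _ _ (ltnW r4) s0 fs.
  by lia.
rewrite /alternation_set /=.
have -> : forall P : Prop, (weyl w /\ P) <-> P by move=> P; tauto.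
rewrite (alternation_perm _ _ _ _ _ _ r1 lE m0 ws) -i0.
split=> [[/(congr1 val) /= s0 fs le]|[s0 fs le]].
  have [s123E _] := s123 (etrans s0 (inordK (ltn0Sn r))) fs.
  split=> //; first by rewrite s0 inordK.
  have := le 2%N (ltnW r4) isT; rewrite M2 !big_ord_recr !big_ord0 /= s0 inordK //; lia.
have [s123E l1] := s123 s0 fs.
split=> // [|]; first by apply/val_inj; rewrite /= s0 inordK.
case=> [|[|[|//]]] _ _; rewrite !big_ord_recr !big_ord0 /= s0 ?M2 //; lia.
Qed.

(** All six permutations of 1, 2, 3 are candidates. The criterion fails only if m_4 = 1 and 3 is
    sent to 1, which happens for s_3 s_2 and s_2 s_3 s_2. *)
Lemma alternation_le4 (r l : nat) (m : nat -> nat) :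
  (4 <= r)%N -> l = (\sum_(1 <= i < r.+1) m i * i)%N ->
  (forall j, (5 <= j <= r)%N -> m j = 0%N) -> m 4%N <> 0%N ->
  let A := alternation_set (l%:R *: varpi r 1%N)
    (\sum_(1 <= i < r.+1) (m i)%:R *: varpi r i) in
  let s := refl r in
  (m 4%N = 1%N -> A = [set 1%:M; s 2%N; s 3%N; s 2%N *m s 3%N]) /\
  ((2 <= m 4%N)%N ->
     A = [set 1%:M; s 2%N; s 3%N; s 2%N *m s 3%N; s 3%N *m s 2%N; s 2%N *m s 3%N *m s 2%N]).
Proof.
move=> r4 lE m0 m4 A s.
have r2 : (1 <= 2 <= r)%N by lia.
have r3 : (1 <= 3 <= r)%N by lia.
have e2 := eps_refl _ _ r2; have e3 := eps_refl _ _ r3.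
have e23 := eps_perm_mul _ _ _ _ _ e2 e3.
have e32 := eps_perm_mul _ _ _ _ _ e3 e2.
have e232 := eps_perm_mul _ _ _ _ _ e23 e2.
have w1 : weyl (1%:M : 'M[rat]_r) by apply: weyl_id.
have w2 := weyl_refl1 _ _ r2; have w3 := weyl_refl1 _ _ r3.
have w23 := weyl_refl r2 w3; have w32 := weyl_refl r3 w2.
have w232 : weyl (refl r 2%N *m refl r 3%N *m refl r 2%N).
  by rewrite -mulmxA; apply: weyl_refl.
have memA w t : weyl w -> eps r *m w = perm_mx t *m eps r ->
    A w <-> [/\ t (inord 0) = 0%N :> nat,
      forall j : 'I_r.+1, (4 <= j)%N -> t j = j & (3 <= m 4%N + t (inord 3))%N].
  exact: alternation_perm_le4.
have AW w : A w -> weyl w by case.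
(* From here on [A] is known only through [memA] and [AW]. *)
clearbody A.
have tail1 (j : 'I_r.+1) : (4 <= j)%N -> (1%g : 'S_r.+1) j = j by rewrite perm1.
have tail2 (j : 'I_r.+1) : (4 <= j)%N -> adj r 2%N j = j.
  by move=> j4; apply/val_inj; rewrite /= val_adj //; do 2?case: eqP; lia.
have tail3 (j : 'I_r.+1) : (4 <= j)%N -> adj r 3%N j = j.
  by move=> j4; apply/val_inj; rewrite /= val_adj //; do 2?case: eqP; lia.
have tail23 (j : 'I_r.+1) : (4 <= j)%N -> (adj r 2%N * adj r 3%N)%g j = j.
  by move=> j4; rewrite permM tail2 ?tail3.
have tail32 (j : 'I_r.+1) : (4 <= j)%N -> (adj r 3%N * adj r 2%N)%g j = j.
  by move=> j4; rewrite permM tail3 ?tail2.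
have tail232 (j : 'I_r.+1) : (4 <= j)%N -> (adj r 2%N * adj r 3%N * adj r 2%N)%g j = j.
  by move=> j4; rewrite permM tail23 ?tail2.
have A1 : A 1%:M.
  by apply/(memA _ _ w1 (eps_perm1 r)); split=> //; rewrite perm1 inordK //; lia.
have A2 : A (s 2%N).
  by apply/(memA _ _ w2 e2); split=> //; rewrite val_adj // inordK //=; lia.
have A3 : A (s 3%N).
  by apply/(memA _ _ w3 e3); split=> //; rewrite val_adj // inordK //=; lia.
have A23 : A (s 2%N *m s 3%N).
  by apply/(memA _ _ w23 e23); split=> //; rewrite permM !val_adj // inordK //=; lia.
have A32 : (2 <= m 4%N)%N -> A (s 3%N *m s 2%N).
  by move=> m42; apply/(memA _ _ w32 e32); split=> //; rewrite permM !val_adj // inordK //=; lia.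
have A232 : (2 <= m 4%N)%N -> A (s 2%N *m s 3%N *m s 2%N).
  by move=> m42; apply/(memA _ _ w232 e232); split=> //; rewrite !permM !val_adj // inordK //=; lia.
have cases w : A w -> [\/ w = 1%:M, w = s 2%N, w = s 3%N | w = s 2%N *m s 3%N] \/
    (2 <= m 4%N)%N /\ (w = s 3%N *m s 2%N \/ w = s 2%N *m s 3%N *m s 2%N).
  move=> Aw; have ww := AW _ Aw.
  have [t wt] := weyl_perm _ _ ww.
  move: Aw => /(memA _ _ ww wt) [t0 ft le].
  have /and5P[l1 l2 l3 n12 /andP[n13 n23]] := perm_inord123 _ _ (ltnW r4) t0 ft.
  have wE w' t' : eps r *m w' = perm_mx t' *m eps r ->
      (forall j : 'I_r.+1, (4 <= j)%N -> t' j = j) ->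
      t' (inord 0%N) = 0%N :> nat -> t' (inord 1%N) = t (inord 1%N) :> nat ->
      t' (inord 2%N) = t (inord 2%N) :> nat -> t' (inord 3%N) = t (inord 3%N) :> nat ->
      w = w'.
    move=> wt' ft' t'0 t'1 t'2 t'3; apply: eps_perm_inj wt _.
    suff -> : t = t' by [].
    apply: (perm_eq_initial _ _ _ _ ft ft').
    by case=> [|[|[|[|//]]]] _ _; rewrite ?t0 ?t'0.
  (* The values at 1 and 2 determine the one at 3 and so select one of the six products; when the
     value at 3 is 1, [le] yields m_4 >= 2. *)
  case t1E: (nat_of_ord (t (inord 1%N))) => [|[|[|[|//]]]] in l1 n12 n13 wE *; first by lia.
  - case t2E: (nat_of_ord (t (inord 2%N))) => [|[|[|[|//]]]] in l2 n12 n23 wE *; try lia.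
    + left; apply: Or41; apply: (wE _ _ (eps_perm1 r)) => //; rewrite perm1 inordK //; lia.
    + left; apply: Or43; apply: (wE _ _ e3) => //; rewrite val_adj // inordK //=; lia.
  - case t2E: (nat_of_ord (t (inord 2%N))) => [|[|[|[|//]]]] in l2 n12 n23 wE *; try lia.
    + left; apply: Or42; apply: (wE _ _ e2) => //; rewrite val_adj // inordK //=; lia.
    + right; split; first lia.
      left; apply: (wE _ _ e32) => //; rewrite permM !val_adj // inordK //=; lia.
  - case t2E: (nat_of_ord (t (inord 2%N))) => [|[|[|[|//]]]] in l2 n12 n23 wE *; try lia.
    + left; apply: Or44; apply: (wE _ _ e23) => //; rewrite permM !val_adj // inordK //=; lia.
    + right; split; first lia.
      right; apply: (wE _ _ e232) => //; rewrite !permM !val_adj // inordK //=; lia.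
split=> m4E; apply/seteqP; split=> w.
- by move/cases => [[]|[]] /=; rewrite ?m4E //; tauto.
- by case=> [[[]|]|] /= ->.
- by move/cases => [[]|[]] /=; tauto.
- by case=> [[[[[]|]|]|]|] /= ->; auto.
Qed.

(** * The four claims in terms of the integer d *)

Theorem theorem1p1 (r l : nat) (m : nat -> nat) (hr : (1 <= r)%N) :
  let lambda : 'cV[rat]_r := l%:R *: varpi r 1 in
  let mu : 'cV[rat]_r := \sum_(1 <= i < r.+1) (m i)%:R *: varpi r i in
  let d : int := l%:Z - \sum_(1 <= i < r.+1) i%:Z * (m i)%:Z in
  let s : nat -> 'M[rat]_r := refl r in
  [/\ (d = 0 %[mod r.+1%:Z])%Z -> ~ alternation_set lambda mu (s 1%N),
      d = 0 -> (forall j, (3 <= j <= r)%N -> m j = 0%N) ->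
        alternation_set lambda mu = [set 1%:M],
      (3 <= r)%N -> d = 0 -> (forall j, (4 <= j <= r)%N -> m j = 0%N) ->
        m 3%N <> 0%N ->
        alternation_set lambda mu = [set 1%:M; s 2%N]
    & (4 <= r)%N -> d = 0 -> (forall j, (5 <= j <= r)%N -> m j = 0%N) ->
        m 4%N <> 0%N ->
        (m 4%N = 1%N ->
          alternation_set lambda mu =
            [set 1%:M; s 2%N; s 3%N; s 2%N *m s 3%N]) /\
        ((2 <= m 4)%N ->
          alternation_set lambda mu =
            [set 1%:M; s 2%N; s 3%N; s 2%N *m s 3%N; s 3%N *m s 2%N;
                 s 2%N *m s 3%N *m s 2%N])].
Proof.
move=> lambda mu d s.
(* In naturals, d = 0 says that l is the size of the partition mu. *)
have lE : d = 0 -> l = (\sum_(1 <= i < r.+1) m i * i)%N.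
  move/eqP; rewrite subr_eq0 => /eqP lE.
  apply/eqP; rewrite -eqz_nat lE (big_morph Posz PoszD (erefl (Posz 0))); apply/eqP.
  by apply: eq_bigr => i _; rewrite mulrC.
split=> [_|/lE d0 m3|r3 /lE d0 m4 m3|r4 /lE d0 m5 m4].
- exact: s1_notin_alternation.
- exact: alternation_eq_id.
- exact: alternation_eq_s2.
- exact: alternation_le4.
Qed.
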